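(* Consider the wideband multiple-antenna system described in the context, with $n_\mathrm{t}$ transmit and $n_\mathrm{r}$ receive antennas, spatially white Rayleigh fading (the entries of each $\mathbf{H}_k\in\mathbb{C}^{n_\mathrm{r}\times n_\mathrm{t}}$ are i.i.d. $\mathcal{CN}(0,1)$), and spatially white inputs. Then the wideband minimum energy per nat is $\bar{\eta}=1/n_\mathrm{r}$, and for every $\eta\ge 1/n_\mathrm{r}$ the wideband outage exponent is $$\mathcal{E}(\eta)=n_\mathrm{t}n_\mathrm{r}\cdot\left[\frac{1}{n_\mathrm{r}\eta}-1+\log(n_\mathrm{r}\eta)\right].$$
   Context: Setting. There are $K$ parallel channels $\mathbf{Y}_k=\mathbf{H}_k\mathbf{X}_k+\mathbf{Z}_k$, $k=1,\ldots,K$, with noise $\mathbf{Z}_k\sim\mathcal{CN}(\mathbf{0},\mathbf{I}_{n_\mathrm{r}\times n_\mathrm{r}})$, inputs $\mathbf{X}_k\sim\mathcal{CN}\left(\mathbf{0},\frac{\rho}{n_\mathrm{t}K}\mathbf{I}_{n_\mathrm{t}\times n_\mathrm{t}}\right)$ where $\rho>0$ is the total power, and i.i.d. fading matrices $\mathbf{H}_1,\ldots,\mathbf{H}_K$. $\mathcal{CN}$ denotes the circular-symmetric complex Gaussian law and $\dagger$ the conjugate transpose. The total achievable rate (in nats) is the random variable $$R(K,\rho)=\sum_{k=1}^K\log\det\left(\mathbf{I}_{n_\mathrm{r}\times n_\mathrm{r}}+\frac{\rho}{n_\mathrm{t}K}\mathbf{H}_k\mathbf{H}_k^\dagger\right).$$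 The wideband minimum energy per nat $\bar\eta$ is the deterministic limit in probability of $\rho/R(K,\rho)$ as $K\to\infty$. For an energy per nat $\eta>0$, with target rate $r=\rho/\eta$, the wideband outage exponent is $$\mathcal{E}(\eta):=\lim_{K\to\infty}\frac{-\log\Pr[R(K,\rho)\le r]}{K}.$$ All logarithms are natural. *)

(* Defs.v *)
From mathcomp Require Import all_boot all_order all_algebra.
From mathcomp Require Import complex.
From mathcomp Require Import all_classical all_reals all_analysis.

Set Implicit Arguments.
Unset Strict Implicit.
Unset Printing Implicit Defensive.

Import Order.TTheory GRing.Theory Num.Theory.
Import numFieldNormedType.Exports.

Local Open Scope classical_set_scope.
Local Open Scope ring_scope.

Section probability.
Context (R : realType) (d : measure_display) (T : measurableType d)
  (P : probability T R).

(* [F i] is intended to be a sub-sigma-algebra of the events. *)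
Definition mutually_independent (I : eqType) (F : I -> set (set T)) : Prop :=
  forall (s : seq I) (A : I -> set T), uniq s ->
    (forall i, i \in s -> F i (A i)) ->
    P (\big[setI/setT]_(i <- s) A i) = (\prod_(i <- s) P (A i))%E.

Definition cvg_in_probability (X : nat -> T -> R) (l : R) : Prop :=
  forall e : R, 0 < e ->
    (P [set t | (e <= `|X n t - l|)%R] @[n --> \oo] --> 0)%E.

(* C carries the Borel sets of R * R via z |-> (Re z, Im z). *)
Definition complex_coords (Z : T -> R[i]) (t : T) : R * R :=
  (complex.Re (Z t), complex.Im (Z t)).

Definition sigma_complex (Z : T -> R[i]) : set (set T) :=
  preimage_set_system setT (complex_coords Z) measurable.

(* On m x n complex matrices the Borel sigma-algebra is generated by the
   entries. *)
Definition sigma_mx (m n : nat) (M : T -> 'M[R[i]]_(m, n)) : set (set T) :=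
  <<s [set A | exists i j, sigma_complex (fun t => M t i j) A] >>.

(* CN(0, v): real and imaginary parts are independent N(0, v / 2); the second
   parameter of [normal_prob] is the standard deviation. *)
Definition complex_normal_prob (v : R) : set (R * R) -> \bar R :=
  (normal_prob 0 (Num.sqrt (v / 2)) \x normal_prob 0 (Num.sqrt (v / 2)))%E.

Definition is_complex_normal (v : R) (Z : T -> R[i]) : Prop :=
  measurable_fun setT (complex_coords Z) /\
  forall A : set (R * R), measurable A ->
    P (complex_coords Z @^-1` A) = complex_normal_prob v A.

End probability.

Section wideband_system.
Context (R : realType) (d : measure_display) (T : measurableType d)
  (P : probability T R) (nr nt : nat).
Local Open Scope sesquilinear_scope.

(* [H k] is the fading matrix of channel k, k = 0, 1, ...; the system with K
   channels uses H 0, ..., H K.-1. The last two clauses fix the law of each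
   [H k], so the matrices are also identically distributed. *)
Definition white_rayleigh_fading (H : nat -> T -> 'M[R[i]]_(nr, nt)) : Prop :=
  [/\ mutually_independent P (fun k => sigma_mx (H k)),
      forall k, mutually_independent P
        (fun ij : 'I_nr * 'I_nt => sigma_complex (fun t => H k t ij.1 ij.2))
    & forall k i j, is_complex_normal P 1 (fun t => H k t i j)].

Variable H : nat -> T -> 'M[R[i]]_(nr, nt).

(* The determinant is that of a Hermitian positive definite matrix, hence a
   positive real, and [complex.Re] only casts it from R[i] to R. *)
Definition rate (K : nat) (rho : R) (t : T) : R :=
  \sum_(k < K) ln (complex.Re
    (\det (1%:M + (rho / (nt%:R * K%:R))%:C%C *: (H k t *m (H k t)^t*)))).

(* The event that the rate is 0, where rho / rate takes the value 0 by
   convention, is null for K > 0 under Rayleigh fading. *)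
Definition is_wideband_min_energy_per_nat (rho eta : R) : Prop :=
  cvg_in_probability P (fun K t => rho / rate K rho t) eta.

(* The logarithm is extended-real, with lne 0 = -oo. *)
Definition is_wideband_outage_exponent (rho eta e : R) : Prop :=
  (- lne (P [set t | (rate K rho t <= rho / eta)%R]) * (K%:R^-1)%:E
     @[K --> \oo] --> e%:E)%E.

End wideband_system.

(* Main.v *)
From HB Require Import structures.
Require Import Defs.
From mathcomp Require Import all_boot all_order all_algebra.
From mathcomp Require Import complex.
From mathcomp Require Import all_classical all_reals all_analysis.
From mathcomp Require Import measurable_realfun.
From mathcomp Require Import ring lra.

(* With W_k = |H_k|^2 (the squared Frobenius norm) and c = rho / (nt K), the
   eigenvalues of H_k H_k^* give
     ln (1 + c W_k) <= ln det (1 + c H_k H_k^* ) <= c W_k,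
   and as c tends to 0 both bounds are asymptotically the same, so everything
   reduces to large deviations of the sum S of the W_k.  By independence, and
   since the squared modulus of a CN(0, 1) variable has Laplace transform
   1 / (1 + th), E exp(- th S) = (1 + th)^(- nt nr K).  The upper bound on the
   outage probability is Chernoff's; the lower one needs no change of measure:
   restricting E exp(- th S) to a thin window below the threshold loses only
   terms which Laplace transforms at nearby parameters show to be negligible.
   The optimal parameter for the energy eta is th = nr eta - 1.  The same
   exponential bounds give the convergence in probability of rho / R. *)

Set Implicit Arguments.
Unset Strict Implicit.
Unset Printing Implicit Defensive.

Import Order.TTheory GRing.Theory Num.Theory.
Import numFieldNormedType.Exports.

Local Open Scope classical_set_scope.
Local Open Scope ring_scope.

(** * Densities and independence *)

Section density.
Context d1 d2 (X : measurableType d1) (Y : measurableType d2) (R : realType).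
Variables (mu : {measure set X -> \bar R}) (nu : {measure set Y -> \bar R}).
Variables (phi : X -> Y) (w : X -> R).
Hypotheses (mphi : measurable_fun [set: X] phi)
  (mw : measurable_fun [set: X] w) (w0 : forall x, 0 <= w x).
Hypothesis nuE : forall B : set Y, measurable B ->
  (nu B = \int[mu]_(x in phi @^-1` B) (w x)%:E)%E.
Import HBNNSimple.

Let integral_nnsfun_density (h : {nnsfun Y >-> R}) :
  (\int[nu]_y (h y)%:E = \int[mu]_x (h (phi x) * w x)%:E)%E.
Proof.
rewrite integralT_nnsfun sintegralE.
under [RHS]eq_integral => x _.
  rewrite fimfunE EFinM -fsumEFin// ge0_mule_fsuml; last first.
    by move=> r; rewrite nnfun_muleindic_ge0.
  over.
have mi r : measurable_fun [set: X] (fun x => (\1_(h @^-1` [set r]) (phi x) : R)).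
  exact: measurableT_comp.
rewrite ge0_integral_fsum//; last 2 first.
- move=> r; apply/measurable_EFinP; apply: measurable_funM => //.
  exact: measurable_funM.
- by move=> r x _; rewrite mule_ge0// ?lee_fin//; exact: nnfun_muleindic_ge0.
apply: eq_fsbigr => r /[!inE] -[y _ <-].
under [RHS]eq_integral do rewrite EFinM -muleA.
rewrite ge0_integralZl//; last 3 first.
- by apply/measurable_EFinP; exact: measurable_funM.
- by move=> x _; rewrite mule_ge0// lee_fin.
- by rewrite lee_fin.
congr (_ * _)%E; rewrite nuE//.
rewrite integral_mkcond; apply: eq_integral => x _.
rewrite patchE indicE.
have -> : (phi x \in h @^-1` [set h y]) = (x \in phi @^-1` (h @^-1` [set h y])).
  by apply/idP/idP; rewrite !inE.
by case: ifP => _; rewrite ?mul1e ?mul0e.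
Qed.

(** Simple functions first, then monotone convergence. It serves twice: with [phi] a random variable
    for products of independent factors, and with [phi] the identity for the normal density. *)
Lemma ge0_integral_density (f : Y -> R) : measurable_fun [set: Y] f ->
  (forall y, 0 <= f y) ->
  (\int[nu]_y (f y)%:E = \int[mu]_x (f (phi x) * w x)%:E)%E.
Proof.
move=> /measurable_EFinP mf f0; pose h := nnsfun_approx measurableT mf.
have hf y : EFin \o h^~ y @ \oo --> (f y)%:E.
  by apply: (cvg_nnsfun_approx measurableT mf) => // x _; rewrite lee_fin.
have hnd x m n : (m <= n)%N -> h m x <= h n x.
  by move=> mn; exact/lefP/(nd_nnsfun_approx measurableT mf).
transitivity (limn (fun n => \int[nu]_y (h n y)%:E))%E.
  rewrite -monotone_convergence//.
  - by apply: eq_integral => y _; apply/esym/cvg_lim => //; exact: hf.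
  - by move=> n; apply/measurable_EFinP; exact: measurable_funP.
  - by move=> n y _; rewrite lee_fin.
  - by move=> y _ m n mn; rewrite lee_fin hnd.
under eq_fun do rewrite integral_nnsfun_density.
rewrite -monotone_convergence//.
- apply: eq_integral => x _; apply/cvg_lim => //.
  under eq_fun do rewrite EFinM.
  by rewrite EFinM; apply: cvgeZr => //; exact: hf.
- move=> n; apply/measurable_EFinP; apply: measurable_funM => //.
  exact: measurableT_comp.
- by move=> n y _; rewrite lee_fin mulr_ge0.
- by move=> y _ m n mn; rewrite lee_fin ler_wpM2r// hnd.
Qed.

End density.

Section independence.
Context d (T : measurableType d) (R : realType) (P : probability T R).

Lemma mutually_independentS (I : eqType) (F G : I -> set (set T)) :
  (forall i, G i `<=` F i) -> mutually_independent P F ->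
  mutually_independent P G.
Proof. by move=> GF iF s A us sA; apply: iF => // i /sA; exact: GF. Qed.

Variables (I : eqType) (X : I -> T -> R).
Hypotheses (mX : forall i, measurable_fun [set: T] (X i))
  (X0 : forall i t, 0 <= X i t)
  (fX : forall i, (\int[P]_t (X i t)%:E < +oo)%E).
Let F i := preimage_set_system [set: T] (X i) (@measurable _ R).
Hypothesis iX : mutually_independent P F.

Let measurable_F i A : F i A -> measurable A.
Proof. by move=> [B mB <-]; exact: mX. Qed.

Let measurable_bigF s (A : I -> set T) : (forall i, i \in s -> F i (A i)) ->
  measurable (\big[setI/setT]_(i <- s) A i).
Proof.
move=> sA; rewrite big_seq; apply: (big_ind measurable) => //.
- by move=> ? ? ? ?; exact: measurableI.
- by move=> i /sA /measurable_F.
Qed.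

Let prod_fin_num (J : eqType) (s : seq J) (f : J -> \bar R) :
  (forall i, i \in s -> 0 <= f i)%E -> (forall i, i \in s -> f i \is a fin_num) ->
  ((0 <= \prod_(i <- s) f i) && (\prod_(i <- s) f i \is a fin_num))%E.
Proof.
move=> f0 ff; rewrite big_seq.
elim/big_ind : _ => [|x y /andP[x0 xf] /andP[y0 yf]|i si].
- by rewrite lee01.
- by rewrite mule_ge0// fin_numM.
- by rewrite f0// ff.
Qed.

(* Events are traded for factors one at a time: as a function of an event B,
   the integral of w over X i @^-1` B is proportional to the law of X i. *)
Let integral_prod_indic s1 s2 (A : I -> set T) : uniq (s1 ++ s2) ->
  (forall i, i \in s2 -> F i (A i)) ->
  (\int[P]_t ((\prod_(i <- s1) X i t) *
              \1_(\big[setI/setT]_(i <- s2) A i) t)%:E =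
   (\prod_(i <- s1) \int[P]_t (X i t)%:E) * \prod_(i <- s2) P (A i))%E.
Proof.
elim: s1 s2 A => [|i s1 IH] s2 A us sA.
  rewrite big_nil mul1e -iX//.
  under eq_integral do rewrite big_nil mul1r.
  by rewrite integral_indic ?setIT//; exact: measurable_bigF.
rewrite big_cons -muleA.
set C := (_ * \prod_(i <- s2) _)%E.
have /andP[C0 Cfin] : ((0 <= C) && (C \is a fin_num))%E.
  have EX0 j : (0 <= \int[P]_t (X j t)%:E)%E.
    by apply: integral_ge0 => t _; rewrite lee_fin.
  have /andP[? ?] := @prod_fin_num _ s1 (fun j => \int[P]_t (X j t)%:E)%E
    (fun j _ => EX0 j) (fun j _ => etrans (ge0_fin_numE (EX0 j)) (fX j)).
  have /andP[? ?] := @prod_fin_num _ s2 (P \o A) (fun _ _ => measure_ge0 _ _)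
    (fun j jA => fin_num_measure _ _ (measurable_F (sA _ jA))).
  by rewrite mule_ge0// fin_numM.
pose w t := (\prod_(i <- s1) X i t) * \1_(\big[setI/setT]_(i <- s2) A i) t.
have c0 : 0 <= fine C by exact: fine_ge0.
pose mXi := isMeasurableFun.Build _ _ _ _ _ (mX i).
pose Xi : {mfun T >-> _} := HB.pack (X i) mXi.
(* The goal becomes the integral of the identity against the law of [X i] scaled by [C], where [C]
   must be a finite nonnegative real. *)
pose nu := mscale (NngNum c0) (distribution P Xi).
(* The absolute value changes nothing on the range of [X i] and makes the integrand nonnegative on
   the whole real line. *)
rewrite (eq_integral (fun t => (`|X i t| * w t)%:E)); last first.
  by move=> t _; rewrite big_cons -mulrA ger0_norm.
have nuE : (\int[nu]_y (`|y|)%:E = \int[P]_t (`|X i t| * w t)%:E)%E.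
  apply: ge0_integral_density => //.
  - apply: measurable_funM; first exact: measurable_prod.
    by apply: measurable_indic; exact: measurable_bigF.
  - by move=> t; rewrite mulr_ge0// prodr_ge0.
  - move=> B mB; rewrite /nu/= /mscale/= fineK//.
    pose A' j := if j == i then X i @^-1` B else A j.
    have is2 : i \notin s2 by move: us => /= /andP[]; rewrite mem_cat negb_or => /andP[].
    have A's2 j : j \in s2 -> A' j = A j.
      by move=> js2; rewrite /A'; case: eqP js2 is2 => // -> ->.
    have := IH (i :: s2) A'; rewrite -cat1s uniq_catCA => /(_ us)/=.
    have mA' j : j \in i :: s2 -> F j (A' j).
      rewrite inE => /predU1P[->|js2]; last by rewrite A's2//; exact: sA.
      by rewrite /A' eqxx; exists B => //; rewrite setTI.
    move=> /(_ mA'); rewrite !big_cons (eq_big_seq _ A's2).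
    rewrite [X in (_ * (_ * X))%E](eq_big_seq (P \o A)); last first.
      by move=> j /A's2 /= ->.
    rewrite {2}/A' eqxx /pushforward muleCA muleC => <-.
    rewrite [RHS]integral_mkcond; apply: eq_integral => t _.
    rewrite patchE /w /A' eqxx indicI/= indicE.
    by case: ifP => _; rewrite ?mul1r// mul0r mulr0.
rewrite -nuE.
rewrite ge0_integral_mscale//; last first.
  by apply/measurable_EFinP; exact: normr_measurable.
rewrite ge0_integral_distribution; last 2 first.
- by apply/measurable_EFinP; exact: normr_measurable.
- by move=> x; rewrite lee_fin.
rewrite muleC fineK//; congr (_ * _)%E.
by apply: eq_integral => t _ /=; rewrite ger0_norm.
Qed.

Lemma expectation_prod_independent s : uniq s ->
  (\int[P]_t (\prod_(i <- s) X i t)%:E = \prod_(i <- s) \int[P]_t (X i t)%:E)%E.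
Proof.
move=> us; have := @integral_prod_indic s [::] (fun=> setT).
rewrite cats0 !big_nil mule1 => <-//.
by apply: eq_integral => t _; rewrite indicT mulr1.
Qed.

End independence.

(** * Determinant of a Gram perturbation of the identity *)

Section gram_determinant.
Context (R : realType).
Local Open Scope sesquilinear_scope.

(** The squared Frobenius norm, spelled out so as to be real-valued and a direct function of the
    [complex_coords] of the entries. *)
Definition sqnorm (m n : nat) (A : 'M[R[i]]_(m, n)) : R :=
  \sum_ij (complex.Re (A ij.1 ij.2) ^+ 2 + complex.Im (A ij.1 ij.2) ^+ 2).

Let trmxC_mul (C : numClosedFieldType) m n p (A : 'M[C]_(m, n)) (B : 'M[C]_(n, p)) :
  (A *m B)^t* = B^t* *m A^t*.
Proof. by rewrite trmx_mul map_mxM. Qed.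

Let trace_gram m n (A : 'M[R[i]]_(m, n)) : \tr (A *m A^t*) = (sqnorm A)%:C%C.
Proof.
rewrite /sqnorm -(pair_bigA _ (fun i j => complex.Re (A i j) ^+ 2 + complex.Im (A i j) ^+ 2))/=.
rewrite rmorph_sum; apply: eq_bigr => i _; rewrite mxE rmorph_sum.
apply: eq_bigr => j _; rewrite !mxE /= add_Re2_Im2.
by rewrite normCK.
Qed.

Let gram_diag_ge0 m n (A : 'M[R[i]]_(m, n)) i : 0 <= (A *m A^t*) i i.
Proof. by rewrite mxE sumr_ge0// => j _; rewrite !mxE mul_conjC_ge0. Qed.

(** Spectral theorem: the Gram matrix is normal, [r] lists its eigenvalues, and their sum is its
    trace. One [r] serves every [c]. *)
Lemma det1D_gram m n (A : 'M[R[i]]_(m, n)) : exists2 r : 'I_m -> R,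
  (forall i, 0 <= r i) /\ \sum_i r i = sqnorm A &
  forall c : R, \det (1%:M + c%:C%C *: (A *m A^t*)) =
    (\prod_i (1 + c * r i))%:C%C.
Proof.
set G := A *m A^t*.
have GtC : G^t* = G by rewrite trmxC_mul trmxCK.
have /orthomx_spectralP GE : G \is normalmx by apply/normalmxP; rewrite GtC.
set Q := spectralmx G in GE; set D := spectral_diag G in GE.
have Qunitary : Q \is unitarymx := spectral_unitarymx G.
have Qunit : Q \in unitmx := spectral_unit G.
(* In the eigenbasis the diagonal matrix is itself the Gram matrix of [Q *m A], so its diagonal
   entries are sums of squared moduli. *)
have D0 i : 0 <= D 0 i.
  have : diag_mx D = (Q *m A) *m (Q *m A)^t*.
    rewrite trmxC_mul -invmx_unitary// -!mulmxA (mulmxA A) -/G GE.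
    by rewrite !mulmxA mulmxV// mul1mx mulmxK.
  by move=> /matrixP/(_ i i); rewrite [LHS]mxE eqxx mulr1n => ->; exact: gram_diag_ge0.
have DE i : (complex.Re (D 0 i))%:C%C = D 0 i by rewrite RRe_real// ger0_real.
exists (fun i => complex.Re (D 0 i)); first split.
- by move=> i; rewrite -ler0c DE.
- apply: complexI; rewrite -trace_gram -/G GE mxtrace_mulC mulmxA mulmxV// mul1mx.
  rewrite mxtrace_diag rmorph_sum; apply: eq_bigr => i _; exact: DE.
- move=> c; have -> : 1%:M + c%:C%C *: G =
      invmx Q *m diag_mx (const_mx 1 + c%:C%C *: D) *m Q.
    rewrite linearD/= linearZ/= mulmxDr mulmxDl.
    by rewrite -scalemxAr -scalemxAl -GE diag_const_mx mulmx1 mulVmx.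
  rewrite !det_mulmx mulrAC -det_mulmx mulVmx// det1 mul1r det_diag.
  rewrite rmorph_prod; apply: eq_bigr => i _.
  by rewrite !mxE rmorphD rmorphM rmorph1/= DE.
Qed.

Lemma prodr1D_ge (I : finType) (f : I -> R) : (forall i, 0 <= f i) ->
  1 + \sum_i f i <= \prod_i (1 + f i).
Proof.
move=> f0.
(* The induction must carry the sign of the partial sum along. *)
have : (1 + \sum_i f i <= \prod_i (1 + f i)) && (0 <= \sum_i f i).
  elim/big_rec2 : _ => [|i x y _ /andP[yx y0]]; first by rewrite addr0 !lexx.
  rewrite addr_ge0// andbT mulrDl mul1r addrCA addrC lerD// ler_peMr//.
  by rewrite (le_trans _ yx)// lerDl.
by case/andP.
Qed.

Lemma prodr1D_le_expR (I : finType) (f : I -> R) : (forall i, 0 <= f i) ->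
  \prod_i (1 + f i) <= expR (\sum_i f i).
Proof.
move=> f0; rewrite expR_sum; apply: ler_prod => i _.
by rewrite addr_ge0// expR_ge1Dx.
Qed.

Lemma det1D_gram_bounds m n (A : 'M[R[i]]_(m, n)) (c : R) : 0 <= c ->
  1 + c * sqnorm A <=
    complex.Re (\det (1%:M + c%:C%C *: (A *m A^t*))) <= expR (c * sqnorm A).
Proof.
move=> c0; have [r [r0 <-] ->]/= := det1D_gram A.
by rewrite mulr_sumr prodr1D_ge ?prodr1D_le_expR// => i; rewrite mulr_ge0.
Qed.

End gram_determinant.

(** * Laplace transform of the complex normal law *)

Section gaussian_laplace.
Context (R : realType).

Let measurable_expR_sqr (th : R) :
  measurable_fun [set: R] (fun x => expR (- th * x ^+ 2)).
Proof.
by apply: measurableT_comp => //; apply: measurable_funM.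
Qed.

Let measurable_expR_sqr2 (th : R) :
  measurable_fun [set: R * R] (fun z => expR (- th * (z.1 ^+ 2 + z.2 ^+ 2))).
Proof.
apply: measurableT_comp => //; apply: measurable_funM => //.
by apply: measurable_funD; exact: measurable_funX.
Qed.

(** The factor [expR (- th * x ^+ 2)] turns the density of variance 1/2 into a multiple of the
    centred normal density of standard deviation [s']; the ratio of the two normalising constants is
    the value. *)
Lemma normal_laplace_sqr (th : R) : -1 < th ->
  (\int[normal_prob 0 (Num.sqrt (1 / 2))]_x (expR (- th * x ^+ 2))%:E =
   ((Num.sqrt (1 + th))^-1)%:E)%E.
Proof.
move=> th1; set s := Num.sqrt (1 / 2).
have u0 : 0 < 1 + th by rewrite -ltrBlDl sub0r.
pose s' : R := Num.sqrt (1 / 2 / (1 + th)).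
have s0 : s != 0 by rewrite gt_eqF// sqrtr_gt0.
have s'0 : s' != 0 by rewrite gt_eqF// sqrtr_gt0 divr_gt0.
have -> : (\int[normal_prob 0%R s]_x (expR (- th * x ^+ 2))%:E =
    \int[lebesgue_measure]_x (expR (- th * x ^+ 2) * normal_pdf 0 s x)%:E)%E.
  apply: (@ge0_integral_density _ _ _ _ _ lebesgue_measure _ id) => //.
  - exact: measurable_normal_pdf.
  - by move=> x; exact: normal_pdf_ge0.
  - exact: measurable_expR_sqr.
transitivity (\int[lebesgue_measure]_x (((Num.sqrt (1 + th))^-1)%:E *
    (normal_pdf 0 s' x)%:E))%E.
  apply: eq_integral => x _; rewrite -EFinM !normal_pdfE//; congr EFin.
  rewrite /normal_peak /normal_fun !subr0 mulrCA -expRD [RHS]mulrA.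
  rewrite -invfM -sqrtrM ?(ltW u0)//.
  congr (_^-1 * expR _).
    congr Num.sqrt; rewrite !sqr_sqrtr ?divr_ge0 ?(ltW u0)//.
    by field; rewrite gt_eqF.
  rewrite !sqr_sqrtr ?divr_ge0 ?(ltW u0)//.
  by field; rewrite gt_eqF.
rewrite ge0_integralZl//; last 2 first.
- by apply/measurable_EFinP; exact: measurable_normal_pdf.
- by move=> x _; rewrite lee_fin normal_pdf_ge0.
by rewrite integral_normal_pdf mule1.
Qed.

Lemma complex_normal_laplace (th : R) : -1 < th ->
  (\int[normal_prob 0 (Num.sqrt (1 / 2)) \x normal_prob 0 (Num.sqrt (1 / 2))]_z
     (expR (- th * (z.1 ^+ 2 + z.2 ^+ 2)))%:E = ((1 + th)^-1)%:E)%E.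
Proof.
move=> th1; have u0 : 0 < 1 + th by rewrite -ltrBlDl sub0r.
have msq : measurable_fun [set: R] (fun x => (expR (- th * x ^+ 2))%:E).
  by apply/measurable_EFinP; exact: measurable_expR_sqr.
rewrite fubini_tonelli1//=; last first.
  by apply/measurable_EFinP; exact: measurable_expR_sqr2.
rewrite /fubini_F/=.
under eq_integral => x _.
  under eq_integral => y _ do rewrite mulrDr expRD EFinM.
  rewrite ge0_integralZl//.
  rewrite normal_laplace_sqr//.
  over.
rewrite ge0_integralZr//.
rewrite normal_laplace_sqr// -EFinM -invfM -expr2 sqr_sqrtr//.
exact: ltW.
Qed.

Lemma is_complex_normal_laplace d (T : measurableType d) (P : probability T R)
    (Z : T -> R[i]) (th : R) : is_complex_normal P 1 Z -> -1 < th ->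
  (\int[P]_t (expR (- th * (complex.Re (Z t) ^+ 2 + complex.Im (Z t) ^+ 2)))%:E
   = ((1 + th)^-1)%:E)%E.
Proof.
move=> [mZ ZE] th1; rewrite -complex_normal_laplace//.
pose RR := (measurableTypeR R * measurableTypeR R)%type.
have mZ' : measurable_fun [set: T] (complex_coords Z : T -> RR) by exact: mZ.
pose mZi := isMeasurableFun.Build _ _ _ _ _ mZ'.
pose Zi : {mfun T >-> RR} := HB.pack (complex_coords Z : T -> RR) mZi.
have mf : measurable_fun [set: RR]
    (fun z : RR => (expR (- th * (z.1 ^+ 2 + z.2 ^+ 2)))%:E).
  by apply/measurable_EFinP; exact: measurable_expR_sqr2.
transitivity (\int[distribution P Zi]_z
    (expR (- th * (z.1 ^+ 2 + z.2 ^+ 2)))%:E)%E.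
  by rewrite (ge0_integral_distribution _ mf).
by apply: eq_measure_integral => A mA _; exact: ZE.
Qed.

End gaussian_laplace.

(** * Measurability of determinants of complex random matrices *)

Section complex_measurability.
Context d (T : measurableType d) (R : realType).
Implicit Types f g : T -> R[i].

(** Coordinatewise measurability is stable under sums, products and conjugation, hence passes to
    every polynomial in the entries and their conjugates. *)
Let cmeasurable f := measurable_fun [set: T] (fun t => complex.Re (f t)) /\
  measurable_fun [set: T] (fun t => complex.Im (f t)).

Let cmeasurable_cst z : cmeasurable (fun=> z).
Proof. by split. Qed.

Let cmeasurableD f g : cmeasurable f -> cmeasurable g ->
  cmeasurable (fun t => f t + g t).
Proof.
move=> [fr fi] [gr gi]; split.
- rewrite (_ : (fun _ => _) = (fun t => complex.Re (f t) + complex.Re (g t))).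
    exact: measurable_funD.
  by apply/funext => t; case: (f t) (g t) => [? ?] [].
- rewrite (_ : (fun _ => _) = (fun t => complex.Im (f t) + complex.Im (g t))).
    exact: measurable_funD.
  by apply/funext => t; case: (f t) (g t) => [? ?] [].
Qed.

Let cmeasurableM f g : cmeasurable f -> cmeasurable g ->
  cmeasurable (fun t => f t * g t).
Proof.
move=> [fr fi] [gr gi]; split.
- rewrite (_ : (fun _ => _) = (fun t => complex.Re (f t) * complex.Re (g t) -
      complex.Im (f t) * complex.Im (g t))).
    by apply: measurable_funB; exact: measurable_funM.
  by apply/funext => t; case: (f t) (g t) => [? ?] [].
- rewrite (_ : (fun _ => _) = (fun t => complex.Re (f t) * complex.Im (g t) +
      complex.Im (f t) * complex.Re (g t))).
    by apply: measurable_funD; exact: measurable_funM.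
  by apply/funext => t; case: (f t) (g t) => [? ?] [].
Qed.

Let cmeasurable_conj f : cmeasurable f -> cmeasurable (fun t => (f t)^*%R).
Proof.
move=> [fr fi]; split.
- rewrite (_ : (fun _ => _) = (fun t => complex.Re (f t)))//.
  by apply/funext => t; case: (f t).
- rewrite (_ : (fun _ => _) = (fun t => - complex.Im (f t))).
    exact: measurable_funN.
  by apply/funext => t; case: (f t).
Qed.

Let cmeasurable_sum I (s : seq I) (f : I -> T -> R[i]) :
  (forall i, cmeasurable (f i)) -> cmeasurable (fun t => \sum_(i <- s) f i t).
Proof.
move=> mf; elim: s => [|i s IH].
  by under eq_fun do rewrite big_nil; exact: cmeasurable_cst.
by under eq_fun do rewrite big_cons; exact: cmeasurableD.
Qed.

Let cmeasurable_prod I (s : seq I) (f : I -> T -> R[i]) :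
  (forall i, cmeasurable (f i)) -> cmeasurable (fun t => \prod_(i <- s) f i t).
Proof.
move=> mf; elim: s => [|i s IH].
  by under eq_fun do rewrite big_nil; exact: cmeasurable_cst.
by under eq_fun do rewrite big_cons; exact: cmeasurableM.
Qed.

Local Open Scope sesquilinear_scope.

Lemma measurable_Re_det1D_gram m n (M : T -> 'M[R[i]]_(m, n)) (c : R) :
  (forall i j, measurable_fun [set: T] (complex_coords (fun t => M t i j))) ->
  measurable_fun [set: T]
    (fun t => complex.Re (\det (1%:M + c%:C%C *: (M t *m (M t)^t*)))).
Proof.
move=> mM.
have cM i j : cmeasurable (fun t => M t i j).
  by have /measurable_fun_pairP[] := mM i j; split.
have cG i j : cmeasurable (fun t => (1%:M + c%:C%C *: (M t *m (M t)^t*)) i j).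
  rewrite (_ : (fun _ => _) = (fun t => (1%:M : 'M[R[i]]_m) i j +
      c%:C%C * \sum_k M t i k * (M t j k)^*%R)); last first.
    apply/funext => t; rewrite !mxE; congr (_ + _ * _).
    by apply: eq_bigr => k _; rewrite !mxE.
  apply: cmeasurableD; first exact: cmeasurable_cst.
  apply: cmeasurableM; first exact: cmeasurable_cst.
  apply: cmeasurable_sum => k; apply: cmeasurableM => //.
  exact: cmeasurable_conj.
suff : cmeasurable (fun t => \det (1%:M + c%:C%C *: (M t *m (M t)^t*))) by case.
(* The determinant unfolds to the Leibniz sum over permutations. *)
apply: cmeasurable_sum => s; apply: cmeasurableM; first exact: cmeasurable_cst.
exact: cmeasurable_prod.
Qed.

End complex_measurability.

(** * White Rayleigh fading *)

Section rayleigh_fading.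
Context (R : realType) (d : measure_display) (T : measurableType d).

Lemma preimage_set_system_comp d1 d2 (U : measurableType d1)
    (V : measurableType d2) (X : T -> U) (f : U -> V) :
  measurable_fun [set: U] f ->
  preimage_set_system [set: T] (f \o X) measurable `<=`
  preimage_set_system [set: T] X measurable.
Proof.
move=> mf A [B mB <-]; exists (f @^-1` B); last by rewrite comp_preimage.
by rewrite -[_ @^-1` _]setTI; exact: mf.
Qed.

Let measurable_add_sqr :
  measurable_fun [set: R * R] (fun z => z.1 ^+ 2 + z.2 ^+ 2).
Proof. by apply: measurable_funD; exact: measurable_funX. Qed.

(** Links the independence of the matrices, stated for [sigma_mx], to that of the real variables
    [sqnorm (H k t)]. *)
Lemma sigma_mx_sqnorm (m n : nat) (M : T -> 'M[R[i]]_(m, n)) :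
  preimage_set_system [set: T] (fun t => sqnorm (M t)) measurable `<=`
  sigma_mx M.
Proof.
move=> A [B mB <-]; rewrite /sigma_mx.
set G := [set A | _].
(* Here [T] carries the sigma-algebra generated by the entries, so that membership in it is plain
   measurability. *)
have : measurable_fun [set: g_sigma_algebraType G] (fun t => sqnorm (M t)).
  apply: measurable_sum => -[i j] /=.
  have mM : @measurable_fun _ _ (g_sigma_algebraType G) _ setT
      (complex_coords (fun t => M t i j)).
    by move=> _ C mC; apply: sub_sigma_algebra; exists i, j; exists C.
  exact: (measurableT_comp measurable_add_sqr mM).
by move=> mS; exact: (mS measurableT).
Qed.

Variables (P : probability T R) (nr nt : nat).
Variable H : nat -> T -> 'M[R[i]]_(nr, nt).
Hypothesis H_rayleigh : white_rayleigh_fading P H.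

Let measurable_entry k i j :
  measurable_fun [set: T] (complex_coords (fun t => H k t i j)).
Proof. by case: H_rayleigh => _ _ /(_ k i j)[]. Qed.

Lemma measurable_sqnorm_fading k :
  measurable_fun [set: T] (fun t => sqnorm (H k t)).
Proof.
apply: measurable_sum => -[i j] /=.
exact: (measurableT_comp measurable_add_sqr (measurable_entry k i j)).
Qed.

Lemma measurable_rate K rho : measurable_fun [set: T] (rate H K rho).
Proof.
apply: measurable_sum => k; apply: measurableT_comp => //.
exact: measurable_Re_det1D_gram.
Qed.

(** The exponential of the sum is a product over the [nr * nt] independent entries, each
    contributing [(1 + th)^-1]. *)
Lemma expectation_exp_sqnorm k (th : R) : -1 < th ->
  (\int[P]_t (expR (- th * sqnorm (H k t)))%:E =
   ((1 + th)^-1 ^+ (nr * nt))%:E)%E.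
Proof.
move=> th1.
pose X (ij : 'I_nr * 'I_nt) t :=
  expR (- th * (complex.Re (H k t ij.1 ij.2) ^+ 2 +
                complex.Im (H k t ij.1 ij.2) ^+ 2)).
have EX ij : (\int[P]_t (X ij t)%:E = ((1 + th)^-1)%:E)%E.
  by apply: is_complex_normal_laplace => //; case: H_rayleigh => _ _; exact.
pose f (z : R * R) := expR (- th * (z.1 ^+ 2 + z.2 ^+ 2)).
have mf : measurable_fun [set: R * R] f.
  by apply: measurableT_comp => //; apply: measurable_funM.
transitivity (\int[P]_t (\prod_ij X ij t)%:E)%E.
  apply: eq_integral => t _; rewrite /sqnorm mulr_sumr expR_sum//.
rewrite expectation_prod_independent ?index_enum_uniq//.
- under eq_bigr do rewrite EX.
  by rewrite prodEFin prodr_const card_prod !card_ord.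
- move=> ij; exact: (measurableT_comp mf (measurable_entry k ij.1 ij.2)).
- by move=> ij t; exact: expR_ge0.
- by move=> ij; rewrite EX ltry.
- case: H_rayleigh => _ /(_ k) + _; apply: mutually_independentS => ij.
  exact: (@preimage_set_system_comp _ _ _ _
    (complex_coords (fun t => H k t ij.1 ij.2)) f mf).
Qed.

(** A general [f] is allowed because the upper bound on the outage probability uses an exponential
    plus a constant. *)
Lemma expectation_prod_sqnorm (f : R -> R) (e : R) K :
  measurable_fun [set: R] f -> (forall x, 0 <= f x) ->
  (forall k, \int[P]_t (f (sqnorm (H k t)))%:E = e%:E)%E ->
  (\int[P]_t (\prod_(k < K) f (sqnorm (H k t)))%:E = (e ^+ K)%:E)%E.
Proof.
move=> mf f0 fe.
under eq_integral do rewrite -(big_mkord xpredT (fun k => f (sqnorm (H k _)))).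
rewrite (@expectation_prod_independent _ _ _ P _ (fun k t => f (sqnorm (H k t))))//.
- under eq_bigr do rewrite fe.
  by rewrite big_mkord prodEFin prodr_const card_ord.
- by move=> k; exact: measurableT_comp (measurable_sqnorm_fading k).
- by move=> k; rewrite fe ltry.
- case: H_rayleigh => + _ _; apply: mutually_independentS => k.
  apply: subset_trans (@sigma_mx_sqnorm _ _ (H k)).
  exact: (@preimage_set_system_comp _ _ _ _ (fun t => sqnorm (H k t)) f mf).
- exact: iota_uniq.
Qed.

End rayleigh_fading.

(** * Exponential bounds for the rate and for the sum of squared norms *)

Section large_deviations.
Context (R : realType) (d : measure_display) (T : measurableType d).
Variables (P : probability T R) (nr nt : nat).
Variable H : nat -> T -> 'M[R[i]]_(nr, nt).
Hypothesis H_rayleigh : white_rayleigh_fading P H.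

Let S K t := \sum_(k < K) sqnorm (H k t).
(** For [-1 < th], the Laplace transform of the Gamma law of shape [nr * nt] and scale 1, the law of
    one squared norm. *)
Let phi (th : R) := (1 + th)^-1 ^+ (nr * nt).

Let measurable_S K : measurable_fun [set: T] (S K).
Proof.
by apply: measurable_sum => k; exact: (measurable_sqnorm_fading H_rayleigh).
Qed.

Lemma sqnorm_ge0 (m n : nat) (A : 'M[R[i]]_(m, n)) : 0 <= sqnorm A.
Proof. by apply: sumr_ge0 => ij _; rewrite addr_ge0 ?sqr_ge0. Qed.

Lemma rate_bounds K (rho : R) t (c := rho / (nt%:R * K%:R)) : 0 <= rho ->
  \sum_(k < K) ln (1 + c * sqnorm (H k t)) <= rate H K rho t <= c * S K t.
Proof.
move=> rho0; have c0 : 0 <= c by rewrite divr_ge0// mulr_ge0.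
rewrite /rate /S mulr_sumr -/c.
have det1 k : 0 < 1 + c * sqnorm (H k t).
  by rewrite ltr_wpDr// mulr_ge0// sqnorm_ge0.
apply/andP; split; apply: ler_sum => k _; have /andP[l u] := det1D_gram_bounds (H k t) c0.
  by rewrite ler_ln// posrE ?det1// (lt_le_trans (det1 k)).
by rewrite -[leRHS]expRK ler_ln// posrE ?expR_gt0// (lt_le_trans (det1 k)).
Qed.

Lemma laplace_S K th : -1 < th ->
  (\int[P]_t (expR (- th * S K t))%:E = (phi th ^+ K)%:E)%E.
Proof.
move=> th1.
rewrite -(expectation_prod_sqnorm (f := fun x => expR (- th * x)) H_rayleigh)//.
- by apply: eq_integral => t _; rewrite /S mulr_sumr expR_sum.
- by apply: measurableT_comp => //; exact: measurable_funM.
- by move=> k; exact: (expectation_exp_sqnorm H_rayleigh).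
Qed.

Lemma probability_le_integral (A : set T) (g : T -> R) : measurable A ->
  measurable_fun [set: T] g -> (forall t, 0 <= g t) ->
  (forall t, A t -> 1 <= g t) -> (P A <= \int[P]_t (g t)%:E)%E.
Proof.
move=> mA mg g0 g1; rewrite -(setIT A) -integral_indic//.
apply: ge0_le_integral => //.
- by apply/measurable_EFinP; exact: measurable_indic.
- exact/measurable_EFinP.
- move=> t _; rewrite lee_fin indicE; case: (boolP (t \in A)) => [/set_mem/g1//|_].
  exact: g0.
Qed.

Lemma measurable_le_cst (X : T -> R) (x : R) : measurable_fun [set: T] X ->
  measurable [set t | X t <= x].
Proof.
move=> mX; have -> : [set t | X t <= x] = [set: T] `&` X @^-1` `]-oo, x].
  by rewrite setTI; apply/seteqP; split=> t /=; rewrite in_itv.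
exact: mX.
Qed.

(* The summand with q covers the values of w for which 1 + c * w > q. *)
Lemma exp_ln1D_le (th c q w : R) : 0 <= th -> 0 < c -> 0 <= w -> 0 < q ->
  expR (- (th / c * ln (1 + c * w))) <=
  expR (- (th / q) * w) + expR (- (th / c * ln q)).
Proof.
move=> th0 c0 w0 q0.
have x0 : 0 < 1 + c * w by rewrite ltr_wpDr// mulr_ge0// ltW.
have [le_q|/ltW ge_q] := leP (1 + c * w) q.
  apply: ler_wpDr; first exact: expR_ge0.
  rewrite ler_expR mulNr lerN2.
  have -> : th / q * w = th / c * (c * w / q) by field; rewrite !gt_eqF.
  apply: ler_wpM2l; first by rewrite divr_ge0// ltW.
  (* With [x = 1 + c * w] this gives [ln x >= 1 - 1 / x = c * w / x], which is at least [c * w / q]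
     when [x <= q]. *)
  have : ln (1 + c * w)^-1 <= (1 + c * w)^-1 - 1.
    have := @le_ln1Dx R ((1 + c * w)^-1 - 1); rewrite addrCA subrr addr0; apply.
    by rewrite -subr_gt0 opprK subrK invr_gt0.
  rewrite lnV ?posrE// lerNl => /(le_trans _); apply.
  rewrite opprB -[X in _ <= X - _](mulfV (lt0r_neq0 x0)).
  have -> : (1 + c * w) / (1 + c * w) - (1 + c * w)^-1 = c * w / (1 + c * w).
    by field; rewrite gt_eqF.
  by apply: ler_wpM2l; [rewrite mulr_ge0// ltW|rewrite lef_pV2// posrE].
apply: ler_wpDl; first exact: expR_ge0.
rewrite ler_expR lerN2; apply: ler_wpM2l; first by rewrite divr_ge0// ltW.
by rewrite ler_ln.
Qed.

(** Chernoff's bound for the lower estimate [\sum_(k < K) ln (1 + c * sqnorm (H k t))] of the rate,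
    with parameter [th / c]. For [q > 1] and [th > 0] the additive error decays geometrically in
    [K], since [c] is of order [1 / K]. *)
Lemma outage_upper_bound K (rho eta th q : R) : (0 < nt)%N -> (0 < K)%N ->
  0 < rho -> 0 < eta -> 0 <= th -> 0 < q ->
  (P [set t | (rate H K rho t <= rho / eta)%R] <=
   ((expR (th * (nt%:R / eta)) *
     (phi (th / q) + expR (- (th * (nt%:R * K%:R) / rho * ln q)))) ^+ K)%:E)%E.
Proof.
move=> nt0 K0 rho0 eta0 th0 q0.
have nt0' : 0 < nt%:R :> R by rewrite ltr0n.
have K0' : 0 < K%:R :> R by rewrite ltr0n.
pose c := rho / (nt%:R * K%:R); have c0 : 0 < c by rewrite divr_gt0// mulr_gt0.
pose A := expR (th * (nt%:R / eta)).
pose B := expR (- (th / c * ln q)).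
have -> : th * (nt%:R * K%:R) / rho = th / c.
  by rewrite /c; field; rewrite !gt_eqF.
pose f w := A * (expR (- (th / q) * w) + B).
have mf : measurable_fun [set: R] f.
  apply: measurable_funM => //; apply: measurable_funD => //.
  by apply: measurableT_comp => //; exact: measurable_funM.
have f0 w : 0 <= f w by rewrite mulr_ge0 ?addr_ge0 ?expR_ge0.
have thq : -1 < th / q by rewrite (@lt_le_trans _ _ 0)// divr_ge0// ltW.
have Ef k : (\int[P]_t (f (sqnorm (H k t)))%:E = (A * (phi (th / q) + B))%:E)%E.
  have mE : measurable_fun [set: T]
      (fun t => (expR (- (th / q) * sqnorm (H k t)))%:E).
    apply/measurable_EFinP; apply: measurableT_comp => //.
    by apply: measurable_funM => //; exact: (measurable_sqnorm_fading H_rayleigh).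
  under eq_integral do rewrite /f EFinM EFinD.
  have A0 : (0 <= A%:E)%E by rewrite lee_fin expR_ge0.
  have B0 : (0 <= B%:E)%E by rewrite lee_fin expR_ge0.
  rewrite ge0_integralZl//; last 2 first.
  - exact: emeasurable_funD.
  - by move=> t _; rewrite adde_ge0.
  rewrite ge0_integralD// (expectation_exp_sqnorm H_rayleigh)//.
  by rewrite integral_cst//= probability_setT mule1.
rewrite -(expectation_prod_sqnorm H_rayleigh K mf f0 Ef).
apply: probability_le_integral.
- by apply: measurable_le_cst; exact: (measurable_rate H_rayleigh).
- apply: measurable_prod => k _.
  exact: (measurableT_comp mf (measurable_sqnorm_fading H_rayleigh k)).
- by move=> t; apply: prodr_ge0.
move=> t /= rt.
have /andP[/le_trans/(_ rt) ln_le _] := rate_bounds K t (ltW rho0).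
(* On the outage event the Chernoff product is at least 1, because [A ^+ K] is the exponential of
   [th / c * (rho / eta)]; each factor is then at most [f (sqnorm (H k t))]. *)
apply: (@le_trans _ _ (\prod_(k < K) (A * expR (- (th / c * ln (1 + c * sqnorm (H k t))))))).
  rewrite big_split/= prodr_const card_ord -expR_sum -expRM_natl -expRD.
  rewrite sumrN -mulr_sumr leNgt expR_lt1 -leNgt subr_ge0.
  have -> : K%:R * (th * (nt%:R / eta)) = th / c * (rho / eta).
    by rewrite /c; field; rewrite !gt_eqF.
  by apply: ler_wpM2l => //; rewrite divr_ge0// ltW.
apply: ler_prod => k _; rewrite mulr_ge0 ?expR_ge0//=.
by rewrite ler_wpM2l ?expR_ge0// exp_ln1D_le// sqnorm_ge0.
Qed.

(* Splits the integral of expR (- th * S K t) at S K t = b * K and a * K, the two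
   tails being estimated by Markov's inequality. *)
Lemma sum_sqnorm_lower_bound K (a b th eps : R) :
  0 <= th -> 0 <= eps -> -1 < th - eps ->
  phi th ^+ K <= expR (- (th * b * K%:R)) *
      fine (P [set t | \sum_(k < K) sqnorm (H k t) <= a * K%:R]) +
    (expR (- (eps * a)) * phi (th - eps)) ^+ K +
    (expR (eps * b) * phi (th + eps)) ^+ K.
Proof.
move=> th0 eps0 the.
have th1 : -1 < th by rewrite (lt_le_trans _ th0).
have the' : -1 < th + eps by rewrite (lt_le_trans _ (addr_ge0 th0 eps0)).
set A := [set t | _].
have mA : measurable A by apply: measurable_le_cst; exact: measurable_S.
have mE x : measurable_fun [set: T] (fun t => (expR (- x * S K t))%:E).
  apply/measurable_EFinP; apply: measurableT_comp => //.
  exact: measurable_funM.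
rewrite -lee_fin !EFinD EFinM fineK ?fin_num_measure//.
rewrite !exprMn_comm; try exact: mulrC.
have PA : P A = (\int[P]_t (\1_A t)%:E)%E by rewrite integral_indic// setIT.
have mI : measurable_fun [set: T] (fun t => (\1_A t : R)%:E).
  by apply/measurable_EFinP; exact: measurable_indic.
have k0 x : (0 <= (expR x)%:E)%E by rewrite lee_fin expR_ge0.
have mZ (x : R) (g : T -> \bar R) : measurable_fun [set: T] g ->
    measurable_fun [set: T] (fun t => x%:E * g t)%E.
  by move=> mg; exact: emeasurable_funM.
rewrite -!expRM_natr !EFinM -!laplace_S// PA.
rewrite -!ge0_integralZl//.
rewrite -!ge0_integralD//.
- apply: ge0_le_integral => //.
  + by apply: emeasurable_funD; [apply: emeasurable_funD|]; exact: mZ.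
  + move=> t _; rewrite -!EFinM -!EFinD lee_fin -!expRD indicE.
    (* Pointwise one term on the right suffices: the second when [S K t] exceeds [a * K], the third
       when it is at most [b * K], the first in between. *)
    have [tA|tA] := boolP (t \in A); last first.
      rewrite mulr0 add0r ler_wpDr ?expR_ge0// ler_expR.
      move: tA; rewrite notin_setE /A/= -/(S K t) => /negP; rewrite -ltNge => aS.
      have -> : - (eps * a) * K%:R + - (th - eps) * S K t =
        eps * (S K t - a * K%:R) - th * S K t by ring.
      by rewrite mulNr lerDr mulr_ge0// subr_ge0 ltW.
    rewrite mulr1; have [Sb|/ltW Sb] := leP (S K t) (b * K%:R).
      rewrite ler_wpDl ?addr_ge0 ?expR_ge0// ler_expR.
      have -> : eps * b * K%:R + - (th + eps) * S K t =
        eps * (b * K%:R - S K t) - th * S K t by ring.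
      by rewrite mulNr lerDr mulr_ge0// subr_ge0.
    rewrite -addrA ler_wpDr ?addr_ge0 ?expR_ge0// ler_expR mulNr lerN2 -mulrA.
    exact: ler_wpM2l.
- by move=> t _; rewrite adde_ge0// mule_ge0// ?lee_fin.
- by apply: emeasurable_funD; exact: mZ.
- exact: mZ.
- exact: mZ.
- exact: mZ.
Qed.

(** Chernoff's bound at the negative Laplace parameter [- eps], which has to stay above -1. *)
Lemma sum_sqnorm_upper_tail K (a eps : R) : 0 <= eps < 1 ->
  (P [set t | (a * K%:R <= \sum_(k < K) sqnorm (H k t))%R] <=
   ((expR (- (eps * a)) * phi (- eps)) ^+ K)%:E)%E.
Proof.
move=> /andP[eps0 eps1].
rewrite exprMn_comm; last exact: mulrC.
rewrite -expRM_natr EFinM -laplace_S ?ltrN2//.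
have mE : measurable_fun [set: T] (fun t => (expR (- - eps * S K t))).
  by apply: measurableT_comp => //; exact: measurable_funM.
rewrite -ge0_integralZl//; last first.
  by apply/measurable_EFinP.
under eq_integral do rewrite -EFinM -expRD.
apply: probability_le_integral.
- have -> : [set t | a * K%:R <= \sum_(k < K) sqnorm (H k t)] =
      [set t | - S K t <= - (a * K%:R)].
    by apply/seteqP; split => t /=; rewrite lerN2.
  by apply: measurable_le_cst; exact: measurable_funN.
- by apply: measurableT_comp => //; apply: measurable_funD => //; exact: measurable_funM.
- by move=> t; exact: expR_ge0.
- move=> t /= aS; rewrite leNgt expR_lt1 -leNgt.
  by rewrite opprK addrC mulNr subr_ge0 -mulrA ler_wpM2l.
Qed.

End large_deviations.

(** * Exponential rates *)

Section asymptotics.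
Context (R : realType).

Lemma near_exprn_le (x e : R) : 0 <= x < 1 -> 0 < e ->
  \forall K \near \oo, x ^+ K <= e.
Proof.
move=> /andP[x0 x1] e0.
have : GRing.exp x @ \oo --> (0 : R) by apply: cvg_expr; rewrite ger0_norm.
move=> /cvgr0Pnorm_le/(_ _ e0); apply: filterS => K.
by rewrite ger0_norm// exprn_ge0.
Qed.

(** Cramér's rate function of the Gamma law of shape [N] at the point [N / u]: the supremum of
    [N * ln (1 + th) - th * N / u], attained at [th = u - 1]. *)
Definition outage_rate (N u : R) : R := N * (1 / u - 1 + ln u).

Lemma outage_rate_gt0 (N u : R) : 0 < N -> 1 < u -> 0 < outage_rate N u.
Proof.
move=> N0 u1; have u0 : 0 < u by rewrite (lt_trans _ u1).
rewrite /outage_rate pmulr_rgt0// div1r.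
have : expR (- ln u) = u^-1 by rewrite expRN lnK.
have : - ln u != 0 by rewrite oppr_eq0 ln_eq0// gt_eqF.
by move=> /expR_gt1Dx + <-; lra.
Qed.

(** The left side is the base in the Chernoff bound at the optimal [th = u0 - 1]. The choice of [q]
    costs a factor of at most [expR (e / 2)]. *)
Lemma upper_base_le (N : nat) (u0 kap e : R) : (0 < N)%N -> 1 < u0 ->
  0 < kap -> 0 < e -> let q := expR (e / (2 * N%:R)) in
  \forall K \near \oo,
  expR ((u0 - 1) * (N%:R / u0)) *
    ((1 + (u0 - 1) / q)^-1 ^+ N + expR (- ((u0 - 1) * (kap * K%:R) * ln q))) <=
  expR (- (outage_rate N%:R u0 - e)).
Proof.
move=> N0 u1 kap0 e0 q.
have N0' : 0 < N%:R :> R by rewrite ltr0n.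
have u0' : 0 < u0 by rewrite (lt_trans _ u1).
have th0 : 0 < u0 - 1 by rewrite subr_gt0.
have q1 : 1 < q by rewrite expR_gt1 divr_gt0// mulr_gt0.
have q0 : 0 < q by exact: expR_gt0.
have qN : q ^+ N = expR (e / 2).
  by rewrite -expRM_natl; congr expR; field; rewrite gt_eqF.
set x := expR (- ((u0 - 1) * kap * ln q)).
have x1 : 0 <= x < 1.
  by rewrite expR_ge0 expR_lt1 oppr_lt0 !mulr_gt0// ln_gt0.
(* The gap between the factors [expR (e / 2)] and [expR e] absorbs the geometrically decaying
   term. *)
have d0 : 0 < u0^-1 ^+ N * (expR e - expR (e / 2)).
  by rewrite mulr_gt0 ?exprn_gt0 ?invr_gt0// subr_gt0 ltr_expR; lra.
have := near_exprn_le x1 d0; apply: filterS => K xK.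
have -> : expR (- ((u0 - 1) * (kap * K%:R) * ln q)) = x ^+ K.
  by rewrite -expRM_natl; congr expR; ring.
have -> : - (outage_rate N%:R u0 - e) =
    (u0 - 1) * (N%:R / u0) + (N%:R * - ln u0 + e).
  by rewrite /outage_rate; field; rewrite gt_eqF.
rewrite [leRHS]expRD ler_wpM2l ?expR_ge0//.
rewrite [leRHS]expRD expRM_natl expRN lnK//.
have : (1 + (u0 - 1) / q)^-1 ^+ N <= u0^-1 ^+ N * expR (e / 2).
  rewrite -qN -exprMn.
  have den0 : 0 < 1 + (u0 - 1) / q by rewrite addr_gt0// divr_gt0.
  apply: lerXn2r; rewrite ?nnegrE ?invr_ge0 ?(ltW den0)//.
    by rewrite mulr_ge0 ?invr_ge0 ?(ltW u0') ?(ltW q0).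
  rewrite -div1r ler_pdivrMr//.
  have -> : u0^-1 * q * (1 + (u0 - 1) / q) = (q + u0 - 1) / u0.
    by field; rewrite !gt_eqF.
  by rewrite ler_pdivlMr//; lra.
by move: xK; rewrite mulrBr; lra.
Qed.

(* The tilt th exceeds the optimal u0 - 1, so that the tilted mean N / (1 + th)
   lies strictly between b and a and both error terms decay relatively to
   phi th ^+ K. *)
Lemma lower_base_le (N : nat) (u0 e : R) : (0 < N)%N -> 1 <= u0 -> 0 < e ->
  let eps := e / (8 * N%:R) in let th := u0 - 1 + 2 * eps in
  let a := N%:R / u0 in let b := N%:R / (u0 + 4 * eps) in
  let phi z := (1 + z)^-1 ^+ N in
  \forall K \near \oo, forall p : R,
  phi th ^+ K <= expR (- (th * b * K%:R)) * p +
    (expR (- (eps * a)) * phi (th - eps)) ^+ K +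
    (expR (eps * b) * phi (th + eps)) ^+ K ->
  expR (- (outage_rate N%:R u0 + e)) ^+ K <= p.
Proof.
move=> N0 u1 e0 eps th a b phi.
have N0' : 0 < N%:R :> R by rewrite ltr0n.
have u0' : 0 < u0 by rewrite (lt_le_trans _ u1).
have eps0 : 0 < eps by rewrite divr_gt0// mulr_gt0.
have u2 : 0 < u0 + 2 * eps by lra.
have phi_th : phi th = (u0 + 2 * eps)^-1 ^+ N.
  by rewrite /phi /th; congr (_^-1 ^+ _); ring.
have phi0 : 0 < phi th by rewrite phi_th exprn_gt0// invr_gt0.
have phiV : (phi th)^-1 = (u0 + 2 * eps) ^+ N by rewrite phi_th exprVn invrK.
pose y1 := expR (- (eps * a)) * phi (th - eps).
pose y2 := expR (eps * b) * phi (th + eps).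
have y1E : y1 / phi th =
    (expR (- (eps / u0)) * ((u0 + 2 * eps) / (u0 + eps))) ^+ N.
  rewrite phiV /y1.
  have -> : expR (- (eps * a)) = expR (- (eps / u0)) ^+ N.
    by rewrite -expRM_natl /a; congr expR; ring.
  have -> : phi (th - eps) = (u0 + eps)^-1 ^+ N.
    by rewrite /phi /th; congr (_^-1 ^+ _); ring.
  by rewrite -!exprMn; congr (_ ^+ _); ring.
have y2E : y2 / phi th =
    (expR (eps / (u0 + 4 * eps)) * ((u0 + 2 * eps) / (u0 + 3 * eps))) ^+ N.
  rewrite phiV /y2.
  have -> : expR (eps * b) = expR (eps / (u0 + 4 * eps)) ^+ N.
    by rewrite -expRM_natl /b; congr expR; ring.
  have -> : phi (th + eps) = (u0 + 3 * eps)^-1 ^+ N.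
    by rewrite /phi /th; congr (_^-1 ^+ _); ring.
  by rewrite -!exprMn; congr (_ ^+ _); ring.
have u01 : 0 < u0 + eps by lra.
have u03 : 0 < u0 + 3 * eps by lra.
have u04 : 0 < u0 + 4 * eps by lra.
(* Amounts to [(u0 + 2 * eps) / (u0 + eps) < 1 + eps / u0], followed by [1 + x <= expR x]. *)
have z1 : 0 <= y1 / phi th < 1.
  have w0 : 0 <= expR (- (eps / u0)) * ((u0 + 2 * eps) / (u0 + eps)).
    by rewrite mulr_ge0 ?expR_ge0// divr_ge0// ltW.
  rewrite y1E exprn_ge0//= expr_lt1// expRN mulrC ltr_pdivrMr ?expR_gt0// mul1r.
  apply: lt_le_trans (expR_ge1Dx _); rewrite ltr_pdivrMr//.
  have -> : (1 + eps / u0) * (u0 + eps) = u0 + 2 * eps + eps * eps / u0.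
    by field; rewrite gt_eqF.
  by rewrite ltrDl divr_gt0// mulr_gt0.
(* Likewise with [x = - (eps / (u0 + 4 * eps))]; what remains is that [(u0 + 3 * eps) ^+ 2] exceeds
   [(u0 + 2 * eps) * (u0 + 4 * eps)] by [eps * eps]. *)
have z2 : 0 <= y2 / phi th < 1.
  have w0 : 0 <= expR (eps / (u0 + 4 * eps)) * ((u0 + 2 * eps) / (u0 + 3 * eps)).
    by rewrite mulr_ge0 ?expR_ge0// divr_ge0// ltW.
  rewrite y2E exprn_ge0//= expr_lt1//.
  rewrite -[X in expR X]opprK expRN mulrC ltr_pdivrMr ?expR_gt0// mul1r.
  apply: lt_le_trans (expR_ge1Dx _).
  have -> : 1 + - (eps / (u0 + 4 * eps)) = (u0 + 3 * eps) / (u0 + 4 * eps).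
    by field; rewrite gt_eqF.
  rewrite ltr_pdivlMr// mulrAC ltr_pdivrMr// -subr_gt0.
  have -> : (u0 + 3 * eps) * (u0 + 3 * eps) - (u0 + 2 * eps) * (u0 + 4 * eps) =
    eps * eps by ring.
  exact: mulr_gt0.
have z3 : 0 <= expR (- (e / 2)) < 1.
  by rewrite expR_ge0 expR_lt1; lra.
have q4 : 0 < 4^-1 :> R by rewrite invr_gt0.
have q2 : 0 < 2^-1 :> R by rewrite invr_gt0.
near=> K => p pK.
(* Each error term is eventually at most a quarter of [phi th ^+ K], so the main term keeps half of
   it. *)
have {}pK : expR (th * b * K%:R) * (phi th ^+ K / 2) <= p.
  rewrite -ler_pdivlMl ?expR_gt0// -expRN.
  have y1K : (y1 / phi th) ^+ K <= 4^-1 by near: K; exact: near_exprn_le.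
  have y2K : (y2 / phi th) ^+ K <= 4^-1 by near: K; exact: near_exprn_le.
  move: y1K y2K; rewrite !expr_div_n !ler_pdivrMr ?(exprn_gt0 K phi0)//.
  by move: pK; rewrite -/y1 -/y2; lra.
apply: (le_trans _ pK).
have z3K : expR (- (e / 2)) ^+ K <= 2^-1 by near: K; exact: near_exprn_le.
(* Half of [e] pays for the factor 1/2. The other half is [4 * (N%:R * eps)]: [h1] and [h2] each
   lose [2 * (N%:R * eps)], whence the 8 in [eps]. *)
have le_e : expR (- (outage_rate N%:R u0 + e)) <=
    expR (th * b) * phi th * expR (- (e / 2)).
  rewrite phi_th -[X in X^-1]lnK ?posrE// -expRN -expRM_natl -!expRD ler_expR.
  have h1 : N%:R * ln (u0 + 2 * eps) <= N%:R * ln u0 + 2 * (N%:R * eps).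
    have -> : u0 + 2 * eps = u0 * (1 + 2 * eps / u0).
      by field; rewrite gt_eqF.
    have v0 : 0 < 2 * eps / u0 by rewrite divr_gt0// mulr_gt0.
    have v1 : 0 < 1 + 2 * eps / u0 by rewrite addr_gt0.
    rewrite lnM ?posrE// mulrDr lerD2l [leRHS]mulrCA ler_pM2l//.
    apply: (le_trans (le_ln1Dx _)); first by rewrite (lt_trans _ v0).
    by rewrite ler_pdivrMr// ler_peMr// mulr_ge0// ltW.
  have h2 : N%:R - N%:R / u0 - 2 * (N%:R * eps) <= th * b.
    have -> : th * b = N%:R - N%:R * (1 + 2 * eps) / (u0 + 4 * eps).
      by rewrite /th /b; field; rewrite gt_eqF.
    have : N%:R * (1 + 2 * eps) / (u0 + 4 * eps) <= N%:R * (1 + 2 * eps) / u0.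
      rewrite ler_wpM2l ?mulr_ge0 ?lef_pV2 ?posrE//; lra.
    have : N%:R * eps / u0 <= N%:R * eps.
      by rewrite ler_pdivrMr// ler_peMr// mulr_ge0// ltW.
    lra.
  have h3 : e = 8 * (N%:R * eps) by rewrite /eps; field; rewrite gt_eqF.
  by rewrite /outage_rate; lra.
apply: le_trans (lerXn2r K _ _ le_e) _; rewrite ?nnegrE ?mulr_ge0 ?expR_ge0 ?(ltW phi0)//.
rewrite !exprMn.
by rewrite -expRM_natr -mulrA ler_wpM2l ?expR_ge0// ler_wpM2l// exprn_ge0// ltW.
Unshelve. all: by end_near.
Qed.

End asymptotics.

(** The bounds at [e = 1] make [p K] eventually a positive real, where [lne] is [ln]; taking
    logarithms and dividing by [K] then gives the limit. *)
Lemma cvg_exponent (R : realType) (p : nat -> \bar R) (I : R) :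
  (forall e, 0 < e -> \forall K \near \oo,
     ((expR (- (I + e)) ^+ K)%:E <= p K <= (expR (- (I - e)) ^+ K)%:E)%E) ->
  (- lne (p K) * (K%:R^-1)%:E @[K --> \oo] --> I%:E)%E.
Proof.
move=> pI.
have pE : \forall K \near \oo, exists2 x : R, 0 < x & p K = x%:E.
  apply: filterS (pI _ ltr01) => K /andP[l u]; exists (fine (p K)).
    rewrite -lte_fin fineK; last first.
      by rewrite fin_numE -ltNye -ltey (lt_le_trans _ l) ?(le_lt_trans u) ?ltNyr ?ltry.
    by rewrite (lt_le_trans _ l)// lte_fin exprn_gt0// expR_gt0.
  rewrite fineK//.
  by rewrite fin_numE -ltNye -ltey (lt_le_trans _ l) ?(le_lt_trans u) ?ltNyr ?ltry.
apply: (@cvg_trans _ ((- ln (fine (p K)) / K%:R)%:E @[K --> \oo])).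
  apply: near_eq_cvg; apply: filterS pE => K [x x0 ->].
  by rewrite lne_EFin//= EFinM EFinN.
apply: cvg_EFin; first by near=> K.
apply/cvgrPdist_le => e e0; near=> K.
have [x x0 px] : exists2 x : R, 0 < x & p K = x%:E by near: K.
have /andP[] : ((expR (- (I + e)) ^+ K)%:E <= p K <= (expR (- (I - e)) ^+ K)%:E)%E.
  by near: K; exact: pI.
rewrite px !lee_fin -!expRM_natr.
have K0 : 0 < K%:R :> R by rewrite ltr0n; near: K; exact: nbhs_infty_gt.
rewrite -{1 2}(lnK x0) !ler_expR /= => l u.
rewrite px /= ler_distlC ler_pdivlMr// ler_pdivrMr//.
by apply/andP; split; lra.
Unshelve. all: by end_near.
Qed.

(** * Outage exponent and minimum energy in the wideband limit *)

Section wideband.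
Context (R : realType) (d : measure_display) (T : measurableType d).
Variables (P : probability T R) (nt nr : nat).
Hypotheses (nt0 : (0 < nt)%N) (nr0 : (0 < nr)%N).
Variable H : nat -> T -> 'M[R[i]]_(nr, nt).
Hypothesis H_rayleigh : white_rayleigh_fading P H.
Variable rho : R.
Hypothesis rho0 : 0 < rho.

Let N := (nr * nt)%N.
Let N0 : (0 < N)%N. Proof. by rewrite muln_gt0 nr0. Qed.
Let nt0' : 0 < nt%:R :> R. Proof. by rewrite ltr0n. Qed.
Let nr0' : 0 < nr%:R :> R. Proof. by rewrite ltr0n. Qed.
Let NE : N%:R = nr%:R * nt%:R :> R. Proof. by rewrite natrM. Qed.

Lemma near_outage_le (eta e : R) : 1 / nr%:R <= eta -> 0 < e ->
  \forall K \near \oo, (P [set t | (rate H K rho t <= rho / eta)%R] <=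
    (expR (- (outage_rate N%:R (nr%:R * eta) - e)) ^+ K)%:E)%E.
Proof.
rewrite ler_pdivrMr// mulrC => u1 e0.
have u0 : 0 < nr%:R * eta by rewrite (lt_le_trans _ u1).
have eta0 : 0 < eta by move: u0; rewrite pmulr_rgt0.
have mO K : measurable [set t | (rate H K rho t <= rho / eta)%R].
  by apply: measurable_le_cst; exact: (measurable_rate H_rayleigh).
(* At [nr%:R * eta = 1] the exponent vanishes and the bound exceeds 1; Chernoff is used only beyond
   this point. *)
move: u1; rewrite le_eqVlt => /predU1P[<-|u1].
  apply: nearW => K; apply: (le_trans (probability_le1 _ (mO K))).
  rewrite /outage_rate divr1 subrr ln1 addr0 mulr0 sub0r opprK lee_fin.
  by rewrite exprn_ege1// ltW// expR_gt1.
have kap0 : 0 < nt%:R / rho by rewrite divr_gt0.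
have := upper_base_le N0 u1 kap0 e0.
set q := expR _ => nearK; near=> K.
have K0 : (0 < K)%N by near: K; exact: nbhs_infty_gt.
have th0 : 0 <= nr%:R * eta - 1 by rewrite subr_ge0 ltW.
apply: (le_trans (outage_upper_bound H_rayleigh nt0 K0 rho0 eta0 th0 (expR_gt0 _ : 0 < q))).
rewrite lee_fin; apply: lerXn2r; rewrite ?nnegrE ?expR_ge0//.
  rewrite mulr_ge0 ?addr_ge0 ?expR_ge0// exprn_ge0// invr_ge0 addr_ge0// divr_ge0//.
  exact: expR_ge0.
have -> : nt%:R / eta = N%:R / (nr%:R * eta).
  by rewrite NE; field; rewrite !gt_eqF.
have -> : (nr%:R * eta - 1) * (nt%:R * K%:R) / rho =
    (nr%:R * eta - 1) * (nt%:R / rho * K%:R) by field; rewrite gt_eqF.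
by near: K.
Unshelve. all: by end_near.
Qed.

(** As the rate is at most [c] times the sum of the squared norms, a sum of at most
    [N / (nr * eta) * K] forces an outage. *)
Lemma near_outage_ge (eta e : R) : 1 / nr%:R <= eta -> 0 < e ->
  \forall K \near \oo, ((expR (- (outage_rate N%:R (nr%:R * eta) + e)) ^+ K)%:E <=
    P [set t | (rate H K rho t <= rho / eta)%R])%E.
Proof.
rewrite ler_pdivrMr// mulrC => u1 e0.
have u0 : 0 < nr%:R * eta by rewrite (lt_le_trans _ u1).
have eta0 : 0 < eta by move: u0; rewrite pmulr_rgt0.
have eps0 : 0 < e / (8 * N%:R) by rewrite divr_gt0// mulr_gt0// ltr0n.
have := lower_base_le N0 u1 e0; apply: filter_app; near=> K => lowK.
have K0 : 0 < K%:R :> R by rewrite ltr0n; near: K; exact: nbhs_infty_gt.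
set eps := e / _ in eps0 lowK.
have := @sum_sqnorm_lower_bound _ _ _ P nr nt H H_rayleigh K
  (N%:R / (nr%:R * eta)) (N%:R / (nr%:R * eta + 4 * eps))
  (nr%:R * eta - 1 + 2 * eps) eps.
set A := [set t | _].
have mA : measurable A.
  apply: measurable_le_cst; apply: measurable_sum => k.
  exact: (measurable_sqnorm_fading H_rayleigh).
move=> low; apply: (@le_trans _ _ (P A)).
  rewrite -[P A]fineK ?fin_num_measure// lee_fin; apply: lowK; apply: low; lra.
apply: le_measure; rewrite ?inE//.
  by apply: measurable_le_cst; exact: (measurable_rate H_rayleigh).
move=> t /= St; have /andP[_ /le_trans] := rate_bounds H K t (ltW rho0); apply.
apply: (@le_trans _ _ (rho / (nt%:R * K%:R) * (N%:R / (nr%:R * eta) * K%:R))).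
  by rewrite ler_wpM2l// divr_ge0 ?mulr_ge0 ?(ltW rho0).
by rewrite le_eqVlt; apply/orP; left; apply/eqP; rewrite NE; field; rewrite !gt_eqF.
Unshelve. all: by end_near.
Qed.

Lemma wideband_outage_exponent (eta : R) : 1 / nr%:R <= eta ->
  is_wideband_outage_exponent P H rho eta (outage_rate N%:R (nr%:R * eta)).
Proof.
move=> eta1; apply: cvg_exponent => e e0.
by apply: filterS2 (near_outage_ge eta1 e0) (near_outage_le eta1 e0) => K -> ->.
Qed.

(** The optimised Chernoff base for the sum of squared norms exceeding [v] times its mean. *)
Let tail_base (v : R) := (expR (- (v - 1)) * v) ^+ N.

Let tail_base_lt1 v : 1 < v -> 0 <= tail_base v < 1.
Proof.
move=> v1; have v0 : 0 < v by rewrite (lt_trans _ v1).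
have w0 : 0 <= expR (- (v - 1)) * v by rewrite mulr_ge0 ?expR_ge0 ?ltW.
rewrite exprn_ge0//= expr_lt1// expRN mulrC ltr_pdivrMr ?expR_gt0// mul1r.
have : v - 1 != 0 by rewrite gt_eqF// subr_gt0.
by move=> /expR_gt1Dx; rewrite addrC subrK.
Qed.

Lemma sum_sqnorm_tail_le (v : R) K : 1 < v ->
  (P [set t | (v * N%:R * K%:R <= \sum_(k < K) sqnorm (H k t))%R] <=
   (tail_base v ^+ K)%:E)%E.
Proof.
move=> v1; have v0 : 0 < v by rewrite (lt_trans _ v1).
(* The parameter [1 - v^-1] minimises the Chernoff bound at level [v * N%:R]. *)
have eps01 : 0 <= 1 - v^-1 < 1.
  by rewrite subr_ge0 invf_le1// (ltW v1)/= ltrBlDl ltrDr invr_gt0.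
apply: (le_trans (sum_sqnorm_upper_tail H_rayleigh K (v * N%:R) eps01)).
rewrite lee_fin le_eqVlt; apply/orP; left; apply/eqP; congr (_ ^+ _).
rewrite opprB subrKC invrK /tail_base exprMn -expRM_natl; congr (expR _ * _).
by field; rewrite gt_eqF.
Qed.

Let rate_ge0 K t : 0 <= rate H K rho t.
Proof.
have /andP[+ _] := rate_bounds H K t (ltW rho0); apply: le_trans.
apply: sumr_ge0 => k _; apply: ln_ge0; rewrite lerDl.
by rewrite mulr_ge0 ?sqnorm_ge0// divr_ge0 ?mulr_ge0 ?(ltW rho0).
Qed.

(** A deviation upwards is an outage at energy [1 / nr%:R + e], whose exponent is positive; a
    deviation downwards needs a sum of squared norms well above its mean. Both probabilities decay
    geometrically. *)
Lemma wideband_min_energy : is_wideband_min_energy_per_nat P H rho (1 / nr%:R).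
Proof.
move=> e e0.
pose eta := 1 / nr%:R + e.
have nr1 : 0 < 1 / nr%:R :> R by rewrite divr_gt0.
have eta0 : 0 < eta by rewrite addr_gt0.
pose I := outage_rate N%:R (nr%:R * eta).
have I0 : 0 < I.
  apply: outage_rate_gt0; first by rewrite ltr0n.
  by rewrite /eta mulrDr div1r mulfV ?gt_eqF// ltrDl mulr_gt0.
(* Capping [e] keeps [1 / nr%:R - e1] positive, so that [v], the ratio of [1 / nr%:R] to it, is
   finite and greater than 1. *)
pose e1 := Num.min e (1 / nr%:R / 2).
have e10 : 0 < e1 by rewrite lt_min e0 divr_gt0.
have e1e : e1 <= e by rewrite ge_min lexx.
have e1n : e1 < 1 / nr%:R.
  have : e1 <= 1 / nr%:R / 2 by rewrite ge_min lexx orbT.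
  by move: nr1; lra.
pose v := (1 - nr%:R * e1)^-1.
have nre1 : 0 < 1 - nr%:R * e1 by rewrite subr_gt0 mulrC -ltr_pdivlMr.
have v1 : 1 < v by rewrite invf_gt1// ltrBlDr ltrDl mulr_gt0.
pose y := expR (- (I - I / 2)).
have y01 : 0 <= y < 1 by rewrite expR_ge0 expR_lt1; lra.
have eta_ge : 1 / nr%:R <= eta by rewrite lerDl ltW.
have I20 : 0 < I / 2 by rewrite divr_gt0.
have mrate K := measurable_rate H_rayleigh K rho.
apply: (@squeeze_cvge _ _ _ _ (cst 0%E) _ (fun K => (y ^+ K + tail_base v ^+ K)%:E)).
- near=> K.
  have K0 : 0 < K%:R :> R by rewrite ltr0n; near: K; exact: nbhs_infty_gt.
  have PA : (P [set t | (rate H K rho t <= rho / eta)%R] <= (y ^+ K)%:E)%E.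
    by near: K; exact: (near_outage_le eta_ge I20).
  rewrite measure_ge0/= EFinD.
  set A := [set t | (rate H K rho t <= rho / eta)%R] in PA *.
  set D := [set t | v * N%:R * K%:R <= \sum_(k < K) sqnorm (H k t)].
  have mA : measurable A by exact: measurable_le_cst.
  have mD : measurable D.
    rewrite /D (_ : mkset _ = [set t | - (\sum_(k < K) sqnorm (H k t)) <=
        - (v * N%:R * K%:R)]).
      apply: measurable_le_cst; apply: measurable_funN; apply: measurable_sum => k.
      exact: (measurable_sqnorm_fading H_rayleigh).
    by apply/seteqP; split => t /=; rewrite lerN2.
  apply: (@le_trans _ _ (P (A `|` D))).
    apply: le_measure; rewrite ?inE//.
    (* Measurability of the inverse is obtained from that of the real power -1, equal to it on
       nonnegative reals. *)
    + have -> : [set t | e <= `|rho / rate H K rho t - 1 / nr%:R|] =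
          [set t | - `|rho * rate H K rho t `^ (-1) - 1 / nr%:R| <= - e].
        apply/seteqP; split => t /=; rewrite lerN2 powR_inv1//; exact: rate_ge0.
      apply: measurable_le_cst; apply: measurable_funN.
      apply: measurableT_comp => //; apply: measurable_funB => //.
      apply: measurable_funM => //.
      exact: (measurableT_comp (measurable_powR _)).
    + exact: measurableU.
    (* A vanishing rate falls into [A], so the convention [rho / 0 = 0] raises no separate case. *)
    move=> t /=; have [rA _|rA] := leP (rate H K rho t) (rho / eta); first by left.
    have r0 : 0 < rate H K rho t by rewrite (lt_trans _ rA)// divr_gt0.
    have : rho / rate H K rho t < eta by rewrite ltr_pdivrMr// mulrC -ltr_pdivrMr.
    rewrite /eta ler_normr => lt_eta.
    rewrite (_ : (e <= _ - _) = false) /=; last by apply/negbTE; rewrite -ltNge; lra.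
    move=> ge_e; right.
    have : rho / rate H K rho t <= 1 / nr%:R - e1 by lra.
    rewrite ler_pdivrMr// => le_rho.
    have /andP[_ le_rate] := rate_bounds H K t (ltW rho0).
    rewrite /D/= -(ler_pM2l rho0).
    have w0 : 0 < (1 / nr%:R - e1) * (nt%:R * K%:R)^-1.
      by rewrite mulr_gt0 ?subr_gt0// invr_gt0 mulr_gt0.
    rewrite -(ler_pM2l w0).
    have -> : (1 / nr%:R - e1) / (nt%:R * K%:R) * (rho * (v * N%:R * K%:R)) = rho.
      by rewrite NE /v; field; rewrite !gt_eqF.
    apply: (le_trans le_rho).
    rewrite [leRHS](_ : _ = (1 / nr%:R - e1) *
        (rho / (nt%:R * K%:R) * \sum_(k < K) sqnorm (H k t))).
      by rewrite ler_pM2l// subr_gt0.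
    by ring.
  apply: (le_trans (measureU2 _ _ _)) => //.
  apply: leeD; last exact: sum_sqnorm_tail_le.
  exact: PA.
- exact: cvg_cst.
- apply: cvg_EFin; first exact: nearW.
  rewrite -[X in _ --> X](addr0 0).
  have geo x : 0 <= x < 1 -> GRing.exp x @ \oo --> (0 : R).
    by move=> /andP[x0 x1]; apply: cvg_expr; rewrite ger0_norm.
  by apply: cvgD; apply: geo => //; exact: tail_base_lt1.
Unshelve. all: by end_near.
Qed.

End wideband.

Theorem mainTheorem8 (R : realType) (d : measure_display)
    (T : measurableType d) (P : probability T R)
    (nt nr : nat) (nt_gt0 : (0 < nt)%N) (nr_gt0 : (0 < nr)%N)
    (H : nat -> T -> 'M[R[i]]_(nr, nt))
    (H_rayleigh : white_rayleigh_fading P H)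
    (rho : R) (rho_gt0 : 0 < rho) :
  is_wideband_min_energy_per_nat P H rho (1 / nr%:R) /\
  forall eta : R, 1 / nr%:R <= eta ->
    is_wideband_outage_exponent P H rho eta
      (nt%:R * nr%:R * (1 / (nr%:R * eta) - 1 + ln (nr%:R * eta))).
Proof.
split; first exact: wideband_min_energy.
move=> eta eta1; rewrite (mulrC nt%:R) -natrM.
exact: wideband_outage_exponent.
Qed.
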